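(* Let $H=(V,E)$ be a connected, hereditary, critical hypergraph, and let $n:=|V|$ and $\rho:=\rho(H)$. Then $\rho\le \frac{n+1}{2}$. Furthermore, either (i) $\rho<\frac{n+1}{2}$ and there is a minimum cover of $H$ containing no singleton, or (ii) $\rho=\frac{n+1}{2}$ and, for every vertex $v\in V$, there is a minimum cover of $H$ that consists of the singleton $\{v\}$ and otherwise only of edges (hyperedges of cardinality $2$).
   Context: A hypergraph is a pair $H=(V,E)$ with $V$ a finite set (of vertices) and $E\subseteq \mathcal{P}(V)$ (the hyperedges), where $\mathcal{P}(V)$ is the power set of $V$. A cover of $H$ is a family $\mathcal{C}\subseteq E$ with $\bigcup_{C\in\mathcal{C}}C=V$. It is assumed throughout that $E$ itself is a cover. $\rho(H)$ denotes the minimum number of hyperedges in a cover of $H$ (so $\rho=0$ if $V=\emptyset$), and a minimum cover is a cover with $\rho(H)$ hyperedges. $H$ is hereditary if every subset of a hyperedge is a hyperedge. For hereditary hypergraphs, minimum covers are by convention always taken to be partitions of $V$ (this is possible, since a vertex contained in several hyperedges of a cover can be deleted from all but one of them). Hyperedges of cardinality $1$ are called singletons and hyperedges of cardinality $2$ are called edges. For $v\in V$, $H-v:=(V\setminus\{v\},\{e\in E: v\notin e\})$. For a hereditary hypergraph, $\rho(H)-1\le\rho(H-v)\le\rho(H)$ always holds; a hereditary hypergraph $H$ is critical if $\rho(H-v)=\rho(H)-1$ for all $v\in V$. A hereditary hypergraph $H=(V,E)$ is connected if the graph $H_2:=(V,E_2)$ is connected, where $E_2$ is the set of edges (hyperedges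 of cardinality $2$) of $H$. *)

(* Defs.v *)
From mathcomp Require Import all_boot.

Set Implicit Arguments.
Unset Strict Implicit.
Unset Printing Implicit Defensive.

(* Vertices live in an ambient finite type T, so that deleting a vertex stays
   within the same type. *)
Record hypergraph (T : finType) := Hypergraph {
  vset : {set T};
  eset : {set {set T}};
  eset_sub : eset \subset powerset vset
}.

Section Hypergraph.

Variable T : finType.
Implicit Types (H : hypergraph T) (C : {set {set T}}).

Definition is_cover H C : bool := (C \subset eset H) && (cover C == vset H).

(* Meaningful when the set of all hyperedges is a cover; otherwise H has no
   cover at all and the value is the default #|eset H|. *)
Definition rho H : nat := #|[arg min_(C < eset H | is_cover H C) #|C|]|.

Definition minimum_cover H C : bool := is_cover H C && (#|C| == rho H).

(* Covers of hereditary hypergraphs are taken to be partitions. A hypergraph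
   may have a minimum cover without singletons but no such cover that is also
   a partition, so this requirement matters. *)
Definition minimum_partition_cover H C : bool :=
  minimum_cover H C && partition C (vset H).

Definition hereditary H : Prop :=
  forall e f : {set T}, e \in eset H -> f \subset e -> f \in eset H.

Lemma del_vertex_sub H (v : T) :
  [set e in eset H | v \notin e] \subset powerset (vset H :\ v).
Proof.
apply/subsetP=> e; rewrite !inE => /andP[eH ve].
by have /subsetP/(_ e eH) := eset_sub H; rewrite inE subsetD1 ve andbT.
Qed.

Definition del_vertex H (v : T) : hypergraph T := Hypergraph (del_vertex_sub H v).

(* rho (H - v) = rho H - 1, written without truncated subtraction. *)
Definition critical H : Prop :=
  forall v : T, v \in vset H -> (rho (del_vertex H v)).+1 = rho H.

Definition edges H : {set {set T}} := [set e in eset H | #|e| == 2].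

Definition adjacent H : rel T := fun x y => [set x; y] \in edges H.

(* Vacuously true of the hypergraph without vertices. *)
Definition connected H : Prop :=
  {in vset H &, forall x y : T, connect (adjacent H) x y}.

End Hypergraph.

(* Main.v *)
Require Import Defs.
From mathcomp Require Import all_boot.
From mathcomp Require Import zify.

(** Among the minimum covers that are partitions, let C0 have the fewest
    singletons. If it has none, all its blocks have at least two vertices, so
    2 rho <= n and the first alternative holds.

    Otherwise let B be the set of blocks of C0 of size at least 3, and let U be
    the set of vertices outside them. The other blocks of C0 form a maximum
    matching of the graph of edges on U ([max_matching_block]), and conversely
    every maximum matching of U completes B to a minimum cover with as few
    singletons as C0 ([optimal_extend]). Let D be the set of vertices missed by
    some maximum matching of U, and A the set of vertices of U outside D with a
    neighbour in D. A vertex of D has no neighbour in a block of B: moving that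
    neighbour would remove a singleton ([optimal_no_big_neighbour]). Hence all
    neighbours of D lie in D or A.

    Gallai-Edmonds theory of the graph on U shows that maximum matchings match A
    into D ([frontier_matched]), and that with A deleted they miss at most one
    vertex of each component K of D ([stability], [gallai]). All of it rests on
    one exchange along an alternating path ([exchange]). Therefore C0 has at most
    (|K| + 1) / 2 blocks meeting K, and no cover has fewer hyperedges meeting K
    ([component_cover]): C0 meets D in as few hyperedges as any cover does.

    If A had a vertex a, criticality would give a minimum cover containing {a}.
    Replacing its hyperedges that meet D by those of C0 would make {a}
    redundant, which is impossible ([frontier_empty]). So D is closed under
    adjacency, and by connectedness D = V is one component. Then there are no
    blocks of size at least 3, and for every v a maximum matching misses v only:
    this is the second alternative. *)

Set Implicit Arguments.
Unset Strict Implicit.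
Unset Printing Implicit Defensive.

(** * Involutions and alternating paths *)

Section AlternatingComponent.

Variables (T : finType) (f g : T -> T) (a : T).
Hypotheses (fK : involutive f) (gK : involutive g) (fa : f a = a).

Let p x := g (f x).
Let k := order p a.

Let p_inj : injective p.
Proof. exact: inj_comp (inv_inj gK) (inv_inj fK). Qed.

Let f_iter i : i <= k -> f (iter i p a) = iter (k - i) p a.
Proof.
elim: i => [|i IH] ik; first by rewrite subn0 /= fa iter_order.
apply: p_inj; rewrite /p fK /= gK IH ?(ltnW ik) //.
by rewrite -[k - i]prednK ?subn_gt0 // -subnS.
Qed.

Let g_iter i : i <= k -> g (iter i p a) = iter (k - i).+1 p a.
Proof. by move=> ik; rewrite iterS -f_iter // /p fK. Qed.

Let iter_eq i j : i < k -> j < k -> iter i p a = iter j p a -> i = j.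
Proof.
move=> ik jk; have := orbit_uniq p a; rewrite /orbit -/k => U.
move/eqP; rewrite -!(nth_traject p (n := k)) // nth_uniq ?size_traject //.
by move/eqP.
Qed.

(** The orbit of a under g \o f is the component of a in the union of the two
    matchings f and g. On this cyclic orbit f and g act as reflections of a
    dihedral group, and two generating reflections of a k-gon have exactly two
    fixed points in all: the component is an alternating path from a to y. *)
Lemma alternating_component : exists (S : {set T}) (y : T),
  [/\ a \in S, y \in S, forall z, (f z \in S) = (z \in S),
      forall z, (g z \in S) = (z \in S)
    & (forall z, z \in S -> (f z == z) = (z == a)) /\
      (forall z, z \in S -> (g z == z) = (z == y))
      \/ [/\ y != a, forall z, z \in S -> (f z == z) = (z \in [set a; y])
           & forall z, z \in S -> g z != z]].
Proof.
have k0 : 0 < k by rewrite /k -orderSpred.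
pose S := [set z in orbit p a]; pose y := iter k.+1./2 p a.
have inS i : iter i p a \in S by rewrite inE -fconnect_orbit fconnect_iter.
have SP z : z \in S -> exists2 i, i < k & z = iter i p a.
  rewrite inE => /trajectP[i ik ->]; by exists i.
have fS z : z \in S -> f z \in S.
  by case/SP=> i ik ->; rewrite f_iter // ltnW.
have gS z : z \in S -> g z \in S.
  by case/SP=> i ik ->; rewrite g_iter // ltnW.
have kk : iter k p a = a by exact: iter_order.
have yE : y = iter (k.+1./2 %% k) p a.
  rewrite /y; have [lt|] := ltnP k.+1./2 k; first by rewrite modn_small.
  move=> ge; have -> : k = 1 by lia.
  by rewrite modn1 /=; have -> : p a = iter k p a; [have -> : k = 1 by lia | ].
exists S, y; split; [exact: (inS 0) | exact: inS | | | ].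
- by move=> z; apply/idP/idP=> /fS; rewrite ?fK.
- by move=> z; apply/idP/idP=> /gS; rewrite ?gK.
(* On exponents modulo k, f is i |-> -i and g is i |-> 1 - i; their fixed
   exponents other than 0 solve 2i = k and 2i = k + 1 respectively. *)
have f_fix i : i < k -> f (iter i p a) = iter i p a -> i = 0 \/ i + i = k.
  case: i => [|i] ik; first by left.
  by rewrite f_iter 1?ltnW // => /iter_eq; right; lia.
have g_fix i : i < k -> g (iter i p a) = iter i p a ->
    i + i = k.+1 \/ i = 0 /\ k = 1.
  case: i => [|[|i]] ik; rewrite g_iter ?(ltnW ik) //.
  - rewrite subn0 iterS kk => E; right; split=> //.
    by case: (ltnP 1 k) => [k1|]; [have := @iter_eq 1 0 k1 k0 E | lia].
  - have -> : (k - 1).+1 = k by lia.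
    by rewrite kk => E; have := @iter_eq 0 1 k0 ik E.
  - by move/iter_eq=> E; left; lia.
case: (boolP (odd k)) => [ok|ek]; [left|right].
  split=> z /SP[i ik ->]; apply/eqP/eqP.
  - by case/f_fix=> // [->//|E]; lia.
  - by move=> ->.
  - case/g_fix=> // [E|[-> k1]]; rewrite /y; last first.
      by move: kk; rewrite k1 /= => ->.
    by congr (iter _ p a); lia.
  - by move=> ->; rewrite /y g_iter; [congr (iter _ p a); lia | lia].
have ya : y != a.
  apply/eqP=> E; have ltk : k.+1./2 < k by lia.
  by have := iter_eq ltk k0 E; lia.
split=> // z /SP[i ik ->].
- rewrite !inE; apply/eqP/orP.
    case/f_fix=> // [->|E]; first by left.
    by right; apply/eqP; congr (iter _ p a); lia.
  case=> /eqP ->; first by rewrite fa.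
  by rewrite /y f_iter; [congr (iter _ p a); lia | lia].
- by apply/eqP => /g_fix[]//; lia.
Qed.

End AlternatingComponent.

Section Pairs.
Variables (T : finType) (f : T -> T).
Hypothesis fK : involutive f.

Definition pairs (Z : {set T}) := [set [set x; f x] | x in Z].

Lemma pairs_partition (Z : {set T}) :
  {in Z, forall x, f x \in Z} -> partition (pairs Z) Z.
Proof.
move=> fZ; apply/and3P; split.
- rewrite eqEsubset; apply/andP; split.
    apply/bigcupsP=> _ /imsetP[x xZ ->].
    by apply/subsetP=> y; rewrite !inE => /orP[]/eqP-> //; exact: fZ.
  apply/subsetP=> x xZ; apply/bigcupP; exists [set x; f x]; last by rewrite set21.
  exact: imset_f.
- apply/trivIsetP=> _ _ /imsetP[x xZ ->] /imsetP[y yZ ->].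
  apply: contraNT => /pred0Pn[z /=].
  rewrite !inE => /andP[/orP[]/eqP-> /orP[]/eqP].
  + by move->.
  + by move->; rewrite fK setUC.
  + by move=> <-; rewrite fK setUC.
  + by move/(inv_inj fK)->.
- by apply/imsetP=> -[x _ /setP/(_ x)]; rewrite !inE eqxx.
Qed.

Lemma pairs_card (Z : {set T}) : {in Z, forall x, f x \in Z} ->
  2 * #|pairs Z| = #|Z| + #|[set x in Z | f x == x]|.
Proof.
move=> fZ; have /card_partition -> := pairs_partition fZ.
have -> : #|[set x in Z | f x == x]| = #|[set e in pairs Z | #|e| == 1]|.
  rewrite -(card_imset _ set1_inj); congr #|pred_of_set _|.
  apply/setP=> e; rewrite !inE; apply/imsetP/andP.
    case=> x; rewrite inE => /andP[xZ /eqP fx] ->; rewrite cards1; split=> //.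
    by apply/imsetP; exists x=> //; rewrite fx setUid.
  case=> /imsetP[x xZ ->]; rewrite cards2 eqSS eqb0 negbK => /eqP fx.
  by exists x; rewrite ?inE ?xZ -?fx ?setUid ?eqxx.
rewrite -[X in _ = _ + X]sum1dep_card big_mkcondr /= -sum1_card big_distrr /=.
rewrite -big_split /=.
apply: eq_bigr => _ /imsetP[x _ ->]; rewrite cards2; by case: eqP.
Qed.

Lemma odd_fix : odd #|[set x | f x == x]| = odd #|T|.
Proof.
have := @pairs_card setT (fun x _ => in_setT _).
rewrite cardsT => /(congr1 odd); rewrite oddM oddD /=.
have -> : [set x in setT | f x == x] = [set x | f x == x].
  by apply/setP=> x; rewrite !inE.
by case: (odd _); case: (odd _).
Qed.

End Pairs.

(** * Gallai-Edmonds theory of maximum matchings *)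

Section Matching.

Variables (T : finType) (e : rel T).
Hypothesis e_sym : symmetric e.
Implicit Types (W X S : {set T}) (f g : {ffun T -> T}).

Lemma card_replace (A : {set T}) x y : y \in A -> #|x |: A :\ y| <= #|A|.
Proof. by move=> yA; rewrite cardsU1 (cardsD1 y A) yA leq_add2r leq_b1. Qed.

Lemma card_remove2 (A : {set T}) x y :
  x \in A -> y \in A -> x != y -> #|A| = #|A :\ x :\ y|.+2.
Proof.
by move=> xA yA xy; rewrite (cardsD1 x) xA (cardsD1 y) !inE yA eq_sym xy.
Qed.

(** A matching inside W is an involution whose moved points lie in W and are
    adjacent to their images; its fixed points are the vertices it misses. *)
Definition matching W f :=
  [forall x, (f (f x) == x) && ((f x != x) ==> (x \in W) && e x (f x))].

(** Points outside W are counted too. For matchings inside the same W this is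
    a common constant, and it lets matchings inside different W be compared
    without tracking W. *)
Definition unmatched f := [set x | f x == x].

Definition max_matching W f := matching W f &&
  [forall g, matching W g ==> (#|unmatched f| <= #|unmatched g|)].

(** The set D of the Gallai-Edmonds decomposition of the graph induced on W. *)
Definition missable W :=
  [set v in W | [exists f, max_matching W f && (f v == v)]].

Lemma matchingP W f : reflect
  (involutive f /\ forall x, f x != x -> x \in W /\ e x (f x)) (matching W f).
Proof.
apply: (iffP forallP) => [H|[fK H] x]; last first.
  by rewrite fK eqxx /=; apply/implyP=> /H[-> ->].
split=> x; have /andP[/eqP ffx /implyP imp] := H x; first by [].
by move/imp/andP.
Qed.

Lemma max_matchingP W f : reflect
  (matching W f /\ forall g, matching W g -> #|unmatched f| <= #|unmatched g|)
  (max_matching W f).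
Proof.
apply: (iffP andP) => -[mf H]; split=> //.
  by move=> g; move/forallP/(_ g)/implyP: H; apply.
by apply/forallP=> g; apply/implyP=> /H.
Qed.

Lemma missableP W v : reflect
  (v \in W /\ exists2 f, max_matching W f & f v = v) (v \in missable W).
Proof.
rewrite inE; apply: (iffP andP) => -[vW].
  by case/existsP=> f /andP[mf /eqP fv]; split=> //; exists f.
by case=> f mf fv; split=> //; apply/existsP; exists f; rewrite mf fv eqxx.
Qed.

Lemma max_matching_le W f g :
  max_matching W f -> matching W g -> #|unmatched g| <= #|unmatched f| ->
  max_matching W g.
Proof.
move=> /max_matchingP[mf Hf] mg le; apply/max_matchingP; split=> // h mh.
exact: leq_trans le (Hf _ mh).
Qed.

Lemma missable_le W f g v : max_matching W f -> matching W g ->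
  #|unmatched g| <= #|unmatched f| -> v \in W -> g v = v -> v \in missable W.
Proof.
move=> mf mg le vW gv; apply/missableP; split=> //.
by exists g => //; exact: max_matching_le mf mg le.
Qed.

Lemma matching_delP W a f :
  matching (W :\ a) f <-> matching W f /\ f a = a.
Proof.
split.
  case/matchingP=> fK H; split; last first.
    by apply/eqP/contraT => /H[]; rewrite !inE eqxx.
  by apply/matchingP; split=> // x /H[]; rewrite !inE => /andP[].
case=> /matchingP[fK H] fa; apply/matchingP; split=> // x fx.
have [xW ex] := H x fx; rewrite !inE xW andbT; split=> //.
by apply: contraNneq fx => ->; rewrite fa.
Qed.

Lemma matching_fix_out W f x : matching W f -> x \notin W -> f x = x.
Proof.
by case/matchingP=> _ H xW; apply/eqP; apply: contraNT xW => /H[].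
Qed.

Lemma odd_unmatched W f : matching W f -> odd #|unmatched f| = odd #|T|.
Proof. by case/matchingP=> fK _; exact: odd_fix fK. Qed.

Definition swap S f g : {ffun T -> T} := [ffun x => if x \in S then g x else f x].

Lemma matching_swap W S f g : matching W f -> matching W g ->
    (forall z, (f z \in S) = (z \in S)) -> (forall z, (g z \in S) = (z \in S)) ->
  matching W (swap S f g).
Proof.
case/matchingP=> fK Hf /matchingP[gK Hg] fS gS; apply/matchingP; split.
  move=> x; rewrite !ffunE; case xS: (x \in S); first by rewrite gS xS gK.
  by rewrite fS xS fK.
by move=> x; rewrite !ffunE; case: ifP => xS; [exact: Hg | exact: Hf].
Qed.

Definition join_pair x y f : {ffun T -> T} :=
  [ffun z => if z == x then y else if z == y then x else f z].

Lemma matching_join W x y f : matching W f -> x != y -> e x y ->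
  x \in W -> y \in W -> f x = x -> f y = y -> matching W (join_pair x y f).
Proof.
case/matchingP=> fK Hf xy exy xW yW fx fy.
have yx : (y == x) = false by rewrite eq_sym; apply: negbTE.
apply/matchingP; split=> z; rewrite !ffunE.
  case: (eqVneq z x) => [->|zx]; first by rewrite yx eqxx.
  case: (eqVneq z y) => [->|zy]; first by rewrite eqxx.
  have -> : (f z == x) = false.
    by apply: contraNF zx => /eqP E; rewrite -fx -E fK.
  have -> : (f z == y) = false.
    by apply: contraNF zy => /eqP E; rewrite -fy -E fK.
  exact: fK.
case: (eqVneq z x) => [->|zx] //; case: (eqVneq z y) => [->|zy] //.
  by rewrite e_sym.
exact: Hf.
Qed.

Lemma unmatched_join x y f : x != y ->
  unmatched (join_pair x y f) = unmatched f :\ x :\ y.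
Proof.
move=> xy; apply/setP=> z; rewrite !inE ffunE.
case: (eqVneq z x) => [->|zx]; first by rewrite eq_sym (negbTE xy) andbF.
by case: (eqVneq z y) => [->|zy] //=; rewrite (negbTE xy).
Qed.

(** Exchanging f and g along the alternating path that starts at x. The path
    cannot end at another point missed by f: it would augment f. So it ends at
    a point y missed by g, and the exchange trades x for y. *)
Lemma exchange W f g x : max_matching W f -> matching W g -> f x = x ->
  exists y, [/\ g y = y,
    exists2 f', max_matching W f' & f' y = y
    & exists2 g', matching W g' & unmatched g' = x |: unmatched g :\ y].
Proof.
move=> /max_matchingP[mf Hf] mg fx.
have [fK _] := matchingP _ _ mf; have [gK _] := matchingP _ _ mg.
have [S [y [xS yS fS gS cases]]] := alternating_component fK gK fx.
have mfg := matching_swap mf mg fS gS; have mgf := matching_swap mg mf gS fS.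
case: cases => [[fixf fixg]|[yx fixf fixg]]; last first.
  (* f is maximum, so the component cannot augment it *)
  have /subset_leq_card : unmatched (swap S f g) \subset unmatched f :\ x.
    apply/subsetP=> z; rewrite !inE ffunE; case: ifP => zS.
      by rewrite (negbTE (fixg z zS)).
    by move=> ->; rewrite andbT; apply: contraFN zS => /eqP->.
  have := Hf _ mfg; have := cardsD1 x (unmatched f); rewrite inE fx eqxx; lia.
have gy : g y = y by apply/eqP; rewrite fixg.
exists y; split=> //.
  have E : unmatched (swap S f g) = y |: unmatched f :\ x.
    apply/setP=> z; rewrite !inE ffunE; case: ifP => zS.
      by rewrite fixg // fixf // andNb orbF.
    case: (eqVneq z y) zS => [->|zy]; first by rewrite yS.
    by case: (eqVneq z x) => [->|zx] //; rewrite xS.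
  have le : #|unmatched (swap S f g)| <= #|unmatched f|.
    by rewrite E card_replace // inE fx.
  exists (swap S f g).
    by apply: max_matching_le mfg le; apply/max_matchingP.
  by rewrite ffunE yS.
exists (swap S g f) => //.
apply/setP=> z; rewrite !inE ffunE; case: ifP => zS.
  by rewrite fixg // fixf // andNb orbF.
case: (eqVneq z x) zS => [->|zx]; first by rewrite xS.
by case: (eqVneq z y) => [->|zy] //; rewrite yS.
Qed.

Definition unmatch X f : {ffun T -> T} :=
  [ffun x => if (x \in X) || (f x \in X) then x else f x].

Lemma matching_unmatch W X f :
  matching W f -> matching (W :\: X) (unmatch X f).
Proof.
case/matchingP=> fK Hf; apply/matchingP; split=> x; rewrite !ffunE.
  by case xX: ((x \in X) || (f x \in X)); 
    [rewrite xX | rewrite fK orbC xX].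
case: ifP => [|xX]; first by rewrite eqxx.
by move/Hf=> [xW ex]; rewrite inE xW andbT; split=> //; case: (x \in X) xX.
Qed.

Lemma unmatch_unmatch X a f : unmatch [set a] (unmatch X f) = unmatch (a |: X) f.
Proof.
apply/ffunP=> x; rewrite !ffunE !inE.
by case: (x \in X); case: (f x \in X); case: (x == a); case: (f x == a);
   rewrite /= ?orbT ?if_same.
Qed.

Lemma unmatch0 f : unmatch set0 f = f.
Proof. by apply/ffunP=> x; rewrite ffunE !inE. Qed.

Section Stability.

Variables (W : {set T}) (a x : T).
Hypotheses (aW : a \in W) (aD : a \notin missable W).
Hypotheses (xD : x \in missable W) (eax : e a x).

Let fa f : max_matching W f -> f a != a.
Proof.
move=> mf; apply: contraNneq aD => E; apply/missableP; split=> //.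
by exists f.
Qed.

Let unmatched_unmatch1 f : max_matching W f ->
  #|unmatched (unmatch [set a] f)| = #|unmatched f|.+2.
Proof.
move=> mf; have na := fa mf; have /max_matchingP[/matchingP[fK _] _] := mf.
have -> : unmatched (unmatch [set a] f) = a |: (f a |: unmatched f).
  apply/setP=> z; rewrite !inE ffunE !inE.
  have [->|za] /= := eqVneq z a; first by rewrite eqxx.
  have -> : (z == f a) = (f z == a) by rewrite -(inj_eq (inv_inj fK)) fK.
  by case: (f z == a); rewrite ?eqxx.
by rewrite !cardsU1 !inE fK eq_sym (negbTE na).
Qed.

(** A maximum matching of W minus a with fewer fixed points would, by parity,
    have at most as many as f, hence be a maximum matching of W missing a. *)
Lemma max_matching_unmatch1 f :
  max_matching W f -> max_matching (W :\ a) (unmatch [set a] f).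
Proof.
move=> mf; have /max_matchingP[mf0 Hf] := mf; apply/max_matchingP; split.
  exact: matching_unmatch.
move=> g /matching_delP[mg ga]; rewrite unmatched_unmatch1 //.
have := odd_unmatched mf0; rewrite -(odd_unmatched mg); have := Hf g mg.
have : ~ #|unmatched g| <= #|unmatched f|.
  by move=> le; move/negP: aD; apply; exact: missable_le mf mg le aW ga.
lia.
Qed.

(** For the inclusion that is not immediate, let M be a maximum matching of W
    minus a that misses b, while b is never missed in W. Trading against a
    maximum matching of W that misses x, M is turned into a matching that misses
    a, b and x; adding the edge between a and x makes it a maximum matching of W
    that misses b. *)
Lemma missable_del : missable (W :\ a) = missable W.
Proof.
have /missableP[xW [N mN Nx]] := xD.
have /max_matchingP[mN0 HN] := mN.
have xa : x != a by apply: contraNneq aD => <-.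
apply/setP=> b; apply/idP/idP; last first.
  move=> bD; have /missableP[bW [f mf fb]] := bD.
  apply/missableP; split.
    by rewrite !inE bW andbT; apply: contraNneq aD => <-.
  exists (unmatch [set a] f); first exact: max_matching_unmatch1.
  by rewrite ffunE fb if_same.
case/missableP=> bWa [M mM Mb].
have {bWa} [ba bW] : b != a /\ b \in W by apply/andP; rewrite !inE in bWa.
apply: contraT => bD.
have bx : b != x by apply: contraNneq bD => ->.
have /max_matchingP[/matching_delP[mM0 Ma] HM] := mM.
have cM : #|unmatched M| <= #|unmatched N|.+2.
  rewrite -(unmatched_unmatch1 mN); apply: HM.
  by have /max_matchingP[] := max_matching_unmatch1 mN.
have [y [My [f' mf' f'y] [g mg Eg]]] := exchange mN mM0 Nx.
(* a and b stay unmatched in g, since neither is missable *)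
have ya : y != a by apply/eqP=> E; have := fa mf'; rewrite -E f'y eqxx.
have yb : y != b.
  apply/eqP=> E; case/negP: bD; apply/missableP; split=> //.
  by exists f'; rewrite -?E.
have fixg z : (g z == z) = (z \in x |: unmatched M :\ y) by rewrite -Eg inE.
have ga : g a = a by apply/eqP; rewrite fixg !inE Ma eqxx [a == y]eq_sym ya orbT.
have gb : g b = b by apply/eqP; rewrite fixg !inE Mb eqxx [b == y]eq_sym yb orbT.
have gx : g x = x by apply/eqP; rewrite fixg !inE eqxx.
have ax : a != x by rewrite eq_sym.
have mj := matching_join mg ax eax aW xW ga gx.
have cg : #|unmatched g| <= #|unmatched M|.
  by rewrite Eg card_replace // inE My.
case/negP: bD; apply: (missable_le mN mj) => //.
  rewrite unmatched_join // -2!ltnS -(@card_remove2 (unmatched g) a x) ?inE ?ga ?gx //.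
  exact: leq_trans cg cM.
by rewrite ffunE (negbTE ba) (negbTE bx).
Qed.

End Stability.

(** The set A of the Gallai-Edmonds decomposition. *)
Definition frontier W :=
  [set a in W :\: missable W | [exists x in missable W, e a x]].

Lemma frontierP W a : reflect
  [/\ a \in W, a \notin missable W & exists2 x, x \in missable W & e a x]
  (a \in frontier W).
Proof.
apply: (iffP idP).
  by rewrite inE inE => /andP[/andP[aD aW] /exists_inP].
by case=> aW aD /exists_inP ex; rewrite inE inE aD aW.
Qed.

(** Once a is deleted its partner is missed by a maximum matching, and the
    deletion of a does not change which vertices can be missed. *)
Lemma frontier_matched W f a : max_matching W f -> a \in frontier W ->
  f a \in missable W.
Proof.
move=> mf /frontierP[aW aD [x xD eax]].
have /max_matchingP[/matchingP[fK Hf] _] := mf.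
have fa : f a != a.
  apply: contraNneq aD => E; apply/missableP; split=> //.
  by exists f.
rewrite -(missable_del aW aD xD eax); apply/missableP; split.
  rewrite !inE fa; have [] // := Hf (f a).
  by rewrite fK eq_sym.
exists (unmatch [set a] f); first exact: max_matching_unmatch1 xD eax _ mf.
by rewrite ffunE !inE fK eqxx orbT.
Qed.

Lemma stability W X : X \subset frontier W ->
  missable (W :\: X) = missable W /\
  forall f, max_matching W f -> max_matching (W :\: X) (unmatch X f).
Proof.
have [n] := ubnP #|X|; elim: n X => // n IH X leX XA.
have [->|[a aX]] := set_0Vmem X.
  by rewrite setD0; split=> // f; rewrite unmatch0.
have [||IHD IHf] := IH (X :\ a).
- by rewrite (cardsD1 a X) aX in leX.
- exact: subset_trans (subsetDl _ _) XA.
have /frontierP[aW aD [x xD eax]] := subsetP XA a aX.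
have aW' : a \in W :\: (X :\ a) by rewrite !inE eqxx.
have E : (W :\: (X :\ a)) :\ a = W :\: X by rewrite setDDl setUC setD1K.
rewrite -IHD in aD xD *; split=> [|f mf].
  by rewrite -E (missable_del aW' aD xD eax).
have := max_matching_unmatch1 aW' aD xD eax (IHf f mf).
by rewrite unmatch_unmatch setD1K // E.
Qed.

(** Being missed by no common maximum matching is a transitive relation on
    missable vertices: this is the step that carries Gallai's lemma along a
    path. *)
Lemma missable_pair_trans W f t u w : max_matching W f ->
    t \in missable W -> u != w -> f u = u -> f w = w ->
  exists2 g, max_matching W g & g t = t /\ (g u = u \/ g w = w).
Proof.
move=> mf /missableP[tW [h mh ht]] uw fu fw.
have /max_matchingP[mf0 Hf] := mf.
have [y [fy _ [g mg Eg]]] := exchange mh mf0 ht.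
have fixg z : (g z == z) = (z \in t |: unmatched f :\ y) by rewrite -Eg inE.
exists g.
  apply: (max_matching_le mf mg).
  by rewrite Eg card_replace // inE fy.
split; first by apply/eqP; rewrite fixg !inE eqxx.
have [uy|uy] := eqVneq u y.
  by right; apply/eqP; rewrite fixg !inE fw eqxx -uy [w == u]eq_sym uw orbT.
by left; apply/eqP; rewrite fixg !inE fu eqxx uy orbT.
Qed.

Lemma missed_nonadjacent W f u w : max_matching W f -> u \in W -> w \in W ->
  f u = u -> f w = w -> u != w -> ~~ e u w.
Proof.
move=> /max_matchingP[mf Hf] uW wW fu fw uw; apply/negP=> euw.
have := Hf _ (matching_join mf uw euw uW wW fu fw).
rewrite unmatched_join // (@card_remove2 (unmatched f) u w) ?inE ?fu ?fw //.
by rewrite ltnNge leqnSn.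
Qed.

Definition missable_adj W : rel T :=
  [rel x y | [&& x \in missable W, y \in missable W & e x y]].

(** Adjacent vertices are never missed together, and by transitivity neither are
    the two ends of a path of missable vertices. *)
Lemma gallai W f u w : max_matching W f -> u \in missable W ->
  connect (missable_adj W) u w -> f u = u -> f w = w -> u = w.
Proof.
move=> mf uD /connectP[p pth ->{w}].
elim: p u f mf uD pth => //= t p IH u f mf uD /andP[/and3P[_ tD eut] pth] fu fw.
apply/eqP; apply: contraT => uw.
have [g mg [gt [gu|gw]]] := missable_pair_trans mf tD uw fu fw.
  have [uW _] := missableP _ _ uD; have [tW _] := missableP _ _ tD.
  have [Eut|ut] := eqVneq u t; last first.
    by have := missed_nonadjacent mg uW tW gu gt ut; rewrite eut.
  rewrite Eut in fu uw.
  by rewrite -(IH t f mf tD pth fu fw) eqxx in uw.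
have E := IH t g mg tD pth gt gw; rewrite -E in fw uw.
have [uW _] := missableP _ _ uD; have [tW _] := missableP _ _ tD.
by have := missed_nonadjacent mf uW tW fu fw uw; rewrite eut.
Qed.

Definition component W x := [set y in missable W | connect (missable_adj W) x y].

Lemma componentE W x y :
  (y \in component W x) = (y \in missable W) && connect (missable_adj W) x y.
Proof. by rewrite in_set. Qed.

Section Component.

Variables (W : {set T}) (f : {ffun T -> T}) (x : T).
Hypotheses (mf : max_matching W f) (xD : x \in missable W).

Let K := component W x.
Let f' := unmatch (frontier W) f.

Let mf' : max_matching (W :\: frontier W) f'.
Proof. by have [_] := stability (subxx (frontier W)); apply. Qed.

Let missable' : missable (W :\: frontier W) = missable W.
Proof. by have [] := stability (subxx (frontier W)). Qed.

(* With the frontier deleted, a missable vertex has only missable neighbours,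
   so matchings stay inside the components. *)
Let f'K z : z \in K -> f' z \in K.
Proof.
move=> zK; have [->//|fz] := eqVneq (f' z) z.
have [/matchingP[fK Hf] _] := max_matchingP _ _ mf'.
move: zK; rewrite !componentE => /andP[zD cz].
have [_ ez] := Hf z fz.
have fzD : f' z \in missable W.
  have [] := Hf (f' z); first by rewrite fK eq_sym.
  rewrite in_setD => /andP[fzF fzW] _; apply: contraNT fzF => fzD.
  apply/frontierP; split=> //; exists z => //; by rewrite e_sym.
rewrite fzD (connect_trans cz) // connect1 //.
by rewrite /missable_adj /= zD fzD.
Qed.

Let f'_fix u w : u \in K -> w \in K -> f' u = u -> f' w = w -> u = w.
Proof.
rewrite !componentE => /andP[uD cu] /andP[wD cw].
apply: (gallai mf'); first by rewrite missable'.
have sym : connect_sym (missable_adj (W :\: frontier W)).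
  by apply: sym_connect_sym => y z; rewrite /missable_adj /= e_sym andbCA.
have E : missable_adj (W :\: frontier W) =2 missable_adj W.
  by move=> y z; rewrite /missable_adj /= missable'.
by apply: (@connect_trans _ _ x); rewrite ?[connect _ u x]sym (eq_connect E).
Qed.

(** Outside the frontier f restricts to a maximum matching, which by Gallai's
    lemma misses at most one vertex of the component; the other pairs that meet
    the component lie inside it. *)
Lemma component_pairs_le : 2 * #|pairs f K| <= #|K|.+1.
Proof.
have [/matchingP[fK Hf] _] := max_matchingP _ _ mf.
have [/matchingP[f'K' _] _] := max_matchingP _ _ mf'.
pose Z := [set z in K | f' z != z].
have f'E z : z \in Z -> f' z = f z.
  by rewrite in_set !ffunE; case: ifP => // _; rewrite eqxx andbF.
have fZ : {in Z, forall z, f z \in Z}.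
  move=> z zZ; rewrite -f'E //; move: zZ; rewrite ![_ \in Z]in_set => /andP[zK fz].
  by rewrite f'K' eq_sym fz andbT; apply: f'K.
have le1 : #|K :\: Z| <= 1.
  apply/card_le1_eqP=> u w; rewrite !in_setD ![_ \in Z]in_set.
  move=> /andP[+ uK]; rewrite uK /= negbK => /eqP fu.
  move=> /andP[+ wK]; rewrite wK /= negbK => /eqP fw.
  exact: f'_fix.
have leK : #|pairs f K| <= #|pairs f Z| + #|K :\: Z|.
  apply: leq_trans (leq_add (leqnn _) (leq_imset_card (fun z => [set z; f z]) _)).
  apply: leq_trans (leq_card_setU _ _); rewrite -imsetU; apply/subset_leq_card.
  by apply/imsetS/subsetP=> z zK; rewrite in_setU in_setD zK andbT orbN.
have := pairs_card fK fZ.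
have -> : [set z in Z | f z == z] = set0.
  apply/setP=> z; rewrite in_set in_set0; apply/negP=> /andP[zZ /eqP fz].
  by have := zZ; rewrite in_set f'E // fz eqxx andbF.
rewrite cards0 addn0 => E.
have cK : #|K| = #|Z| + #|K :\: Z|.
  rewrite -(cardsID Z K); congr (#|pred_of_set _| + _); apply/setIidPr.
  by apply/subsetP=> z; rewrite in_set => /andP[].
rewrite cK -E -addnS; apply: leq_trans (leq_mul (leqnn 2) leK) _.
by rewrite mulnDr leq_add2l mul2n -addnn -addn1 leq_add2l.
Qed.

Hypothesis fx : f x = x.

Lemma component_missed z : z \in K -> f z \in K /\ (f z = z -> z = x).
Proof.
move=> zK; have xK : x \in K by rewrite componentE xD connect0.
have f'x : f' x = x by rewrite ffunE fx if_same.
have E y : f y = y -> f' y = y by rewrite ffunE => ->; rewrite if_same.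
split; last by move=> /E fz; apply: f'_fix.
have := f'K zK; rewrite {1}ffunE; case: ifP => // H _.
by rewrite (f'_fix zK xK) ?fx // ffunE H.
Qed.

Lemma component_pairs_missed : 2 * #|pairs f K| = #|K|.+1.
Proof.
have [/matchingP[fK _] _] := max_matchingP _ _ mf.
rewrite (pairs_card fK) => [|z /component_missed[]//].
have -> : [set z in K | f z == z] = [set x].
  apply/setP=> z; rewrite in_set in_set1.
  apply/andP/eqP => [[/component_missed[_ H] /eqP //]|->].
  by rewrite componentE xD connect0 fx.
by rewrite cards1 addn1.
Qed.

End Component.

End Matching.

(** * Covers of hereditary hypergraphs *)

Section Covers.

Variables (T : finType) (H : hypergraph T).
Hypotheses (coverH : is_cover H (eset H)) (hereditaryH : hereditary H).
Implicit Types (C : {set {set T}}).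

Lemma rho_le C : is_cover H C -> rho H <= #|C|.
Proof. by rewrite /rho; case: arg_minnP => // D _ minD /minD. Qed.

Lemma rho_attained : exists C, minimum_cover H C.
Proof.
by rewrite /minimum_cover /rho; case: arg_minnP => // C CH _; exists C; rewrite CH /=.
Qed.

Lemma eset_vset (e : {set T}) : e \in eset H -> e \subset vset H.
Proof. by move/(subsetP (eset_sub H)); rewrite inE. Qed.

Lemma set1_eset x : x \in vset H -> [set x] \in eset H.
Proof.
have /andP[_ /eqP <-] := coverH => /bigcupP[e eE xe].
by apply: hereditaryH eE _; rewrite sub1set.
Qed.

(** Building covers as the colour classes of a function makes them partitions
    for free, and recolouring one vertex moves it between hyperedges. *)
Lemma partition_cover_of_coloring (c : T -> {set T}) :
    (forall x, x \in vset H -> [set y in vset H | c x == c y] \in eset H) ->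
    #|c @: vset H| <= rho H ->
  minimum_partition_cover H (preim_partition c (vset H)).
Proof.
move=> classE le; have pV := preim_partitionP c (vset H).
rewrite /minimum_partition_cover /minimum_cover pV andbT.
have cov : is_cover H (preim_partition c (vset H)).
  rewrite /is_cover (cover_partition pV) eqxx andbT.
  by apply/subsetP=> _ /imsetP[x xV ->]; apply: classE.
rewrite cov eqn_leq rho_le // andbT; apply: leq_trans le.
have -> : preim_partition c (vset H) =
    (fun l => [set y in vset H | l == c y]) @: (c @: vset H).
  by rewrite -imset_comp.
exact: leq_imset_card.
Qed.

Lemma partition_cover_exists : exists C, minimum_partition_cover H C.
Proof.
have [C /andP[/andP[CE /eqP CV] /eqP card_C]] := rho_attained.
pose c x := odflt set0 [pick e in C | x \in e].
have cP x : x \in vset H -> (c x \in C) && (x \in c x).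
  rewrite -CV /c => /bigcupP[e eC xe]; case: pickP => [e' //|/(_ e)].
  by rewrite eC xe.
exists (preim_partition c (vset H)); apply: partition_cover_of_coloring.
  move=> x xV; have /andP[cxC _] := cP x xV.
  apply: hereditaryH (subsetP CE _ cxC) _; apply/subsetP=> y.
  by rewrite inE => /andP[/cP/andP[_ ?] /eqP->].
rewrite -card_C; apply/subset_leq_card/subsetP=> _ /imsetP[x xV ->].
by have /andP[] := cP x xV.
Qed.

Definition singletons C := [set x | [set x] \in C].

(** Minimality of the number of singletons is what forbids shrinking a hyperedge
    of size at least 3 in favour of a singleton. *)
Definition optimal C := minimum_partition_cover H C /\
  forall C', minimum_partition_cover H C' -> #|singletons C| <= #|singletons C'|.

Lemma optimal_exists : exists C, optimal C.
Proof.
have [C0 mC0] := partition_cover_exists.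
case: (arg_minnP (fun C => #|singletons C|) mC0) => C mC minC.
by exists C.
Qed.

Lemma adjacentP x y :
  reflect ([set x; y] \in eset H /\ x != y) (adjacent H x y).
Proof.
rewrite /adjacent inE cards2.
by case: (x == y); rewrite ?andbT ?andbF; apply: (iffP idP) => [|[]].
Qed.

Lemma adjacent_sym : symmetric (adjacent H).
Proof. by move=> x y; rewrite /adjacent setUC. Qed.

Lemma adjacent_vset x y : adjacent H x y -> (x \in vset H) && (y \in vset H).
Proof.
by case/adjacentP=> /eset_vset/subsetP sV _; rewrite !sV ?set21 ?set22.
Qed.

Lemma adjacent_hyperedge (e : {set T}) x y :
  e \in eset H -> x \in e -> y \in e -> x != y -> adjacent H x y.
Proof.
move=> eE xe ye xy; apply/adjacentP; split=> //; apply: hereditaryH eE _.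
by apply/subsetP=> z; rewrite !inE => /orP[]/eqP->.
Qed.

(** Otherwise y could be moved from b to the block of x: the number of blocks
    does not grow, x is no longer a singleton, and b keeps at least two
    vertices. *)
Lemma optimal_no_big_neighbour C b x y : optimal C -> [set x] \in C ->
  b \in C -> y \in b -> 2 < #|b| -> ~~ adjacent H x y.
Proof.
move=> [/andP[/andP[/andP[CE _] /eqP card_C] pC] minC] xC bC yb b2.
apply/negP=> /adjacentP[xyE xy].
have tC := partition_trivIset pC.
have pV z : z \in vset H -> pblock C z \in C /\ z \in pblock C z.
  by move=> zV; rewrite pblock_mem ?mem_pblock // (cover_partition pC).
have xV : x \in vset H by apply: (subsetP (eset_vset xyE)); rewrite set21.
have yV : y \in vset H by apply: (subsetP (eset_vset xyE)); rewrite set22.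
have px : pblock C x = [set x] by apply: def_pblock; rewrite ?set11.
have py : pblock C y = b by apply: def_pblock.
(* A block of the recoloured partition is {x, y} or lies in a block of C. *)
pose c z := if z == y then [set x] else pblock C z.
have cx : c x = [set x] by rewrite /c (negbTE xy).
have cy : c y = [set x] by rewrite /c eqxx.
have mC' : minimum_partition_cover H (preim_partition c (vset H)).
  apply: partition_cover_of_coloring => [z zV|].
    have [cz|cz] := eqVneq (c z) [set x].
      apply: hereditaryH xyE _; apply/subsetP=> w.
      rewrite cz !inE /c => /andP[wV].
      have [->|wy] := eqVneq w y; first by rewrite orbT.
      by move/eqP=> E; have [_] := pV w wV; rewrite -E inE => /eqP->; rewrite eqxx.
    have zy : z != y by apply: contraNneq cz => ->; rewrite cy.
    have [pzC _] := pV z zV.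
    apply: hereditaryH (subsetP CE _ pzC) _; apply/subsetP=> w.
    rewrite inE => /andP[wV /eqP cw]; have wy : w != y.
      by apply: contraNneq cz => E; rewrite cw E cy.
    by move: cw; rewrite /c (negbTE zy) (negbTE wy) => ->; have [] := pV w wV.
  rewrite -card_C; apply/subset_leq_card/subsetP=> _ /imsetP[z zV ->].
  by rewrite /c; case: ifP => // _; have [] := pV z zV.
have /subset_leq_card : singletons (preim_partition c (vset H)) \subset
    singletons C :\ x.
  apply/subsetP=> z; rewrite inE => /imsetP[u uV E].
  have cz w : w \in vset H -> c z = c w -> w = z.
    move=> wV czw; apply/set1P; rewrite E inE wV /=.
    have : z \in [set z] by rewrite set11.
    by rewrite E inE => /andP[_ /eqP->]; apply/eqP.
  have zV : z \in vset H.
    have : z \in [set z] by rewrite set11.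
    by rewrite E inE => /andP[].
  have zx : z != x.
    by apply/eqP=> zx; move: xy; rewrite -zx (cz y) ?eqxx // zx cx cy.
  have zy : z != y.
    by apply/eqP=> zy; move: xy; rewrite -zy (cz x) ?eqxx // zy cx cy.
  rewrite in_setD1 zx inE; have [pzC zp] := pV z zV.
  have sp : pblock C z \subset [set z; y].
    apply/subsetP=> w wp; rewrite !inE; have [|wy] := eqVneq w y; first by rewrite orbT.
    rewrite orbF; apply/eqP/cz.
      by apply: (subsetP (eset_vset (subsetP CE _ pzC))).
    by rewrite /c (negbTE zy) (negbTE wy) (same_pblock tC wp).
  have yp : y \notin pblock C z.
    apply/negP=> /(same_pblock tC) E'; have := subset_leq_card sp.
    by rewrite -E' py cards2 leqNgt (leq_trans _ b2) //; case: (z != y).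
  suff <- : pblock C z = [set z] by [].
  apply/eqP; rewrite eqEsubset sub1set zp andbT; apply/subsetP=> w wp.
  have := subsetP sp w wp; rewrite !inE => /orP[//|/eqP wy].
  by rewrite -wy wp in yp.
have := minC _ mC'; have := cardsD1 x (singletons C).
rewrite [x \in _]inE xC => -> le1 le2.
by have := leq_trans le1 le2; rewrite ltnn.
Qed.

Lemma critical_singleton_cover a : critical H -> a \in vset H ->
  exists C, [/\ is_cover H C, [set a] \in C & #|C| <= rho H].
Proof.
move=> crit aV; rewrite -(crit a aV).
have covD : is_cover (del_vertex H a) (eset (del_vertex H a)).
  rewrite /is_cover subxx eqEsubset /=; apply/andP; split.
    by apply/bigcupsP=> e /(subsetP (del_vertex_sub H a)); rewrite inE.
  apply/subsetP=> x; rewrite in_setD1 => /andP[xa xV]; apply/bigcupP.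
  by exists [set x]; rewrite ?set11 // !inE set1_eset // eq_sym.
rewrite /rho; case: arg_minnP => // C /andP[CE /eqP CV] _.
exists ([set a] |: C); split; rewrite ?setU11 //; last first.
  by rewrite cardsU1 -add1n leq_add2r leq_b1.
apply/andP; split.
  rewrite subUset sub1set set1_eset //=; apply: subset_trans CE _.
  by apply/subsetP=> e; rewrite inE => /andP[].
by rewrite /cover bigcup_setU big_set1 -/(cover C) CV /= setD1K.
Qed.

End Covers.

(** * Covers built from an optimal cover and a matching *)

Section FromMatching.

Variables (T : finType) (H : hypergraph T) (C0 : {set {set T}}).
Hypotheses (coverH : is_cover H (eset H)) (hereditaryH : hereditary H).
Hypothesis optC0 : optimal H C0.
Implicit Types (f g : {ffun T -> T}) (C : {set {set T}}) (c : {set T}).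

Let V := vset H.
Let B := [set b in C0 | 2 < #|b|].
Let U := V :\: cover B.

(** With the hyperedges of size at least 3 of C0 kept, a matching f of the
    remaining vertices is completed to a cover by its edges and, for each vertex
    it misses, a singleton. *)
Definition extend f := B :|: pairs f U.

Let pC0 : partition C0 V. Proof. by have [/andP[]] := optC0. Qed.
Let C0E : C0 \subset eset H.
Proof. by have [/andP[/andP[/andP[]]]] := optC0. Qed.
Let card_C0 : #|C0| = rho H.
Proof. by have [/andP[/andP[_ /eqP]]] := optC0. Qed.

Let BC0 : B \subset C0. Proof. by apply/subsetP=> b; rewrite inE => /andP[]. Qed.

Let UV x : x \in U -> x \in V. Proof. by rewrite inE => /andP[]. Qed.

Let coverBV : cover B \subset V.
Proof.
rewrite -(cover_partition pC0); apply/bigcupsP=> b /(subsetP BC0) bC.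
exact: bigcup_sup.
Qed.

Let fU f : matching (adjacent H) U f -> {in U, forall x, f x \in U}.
Proof.
case/matchingP=> fK Hf x xU; have [->//|fx] := eqVneq (f x) x.
by have [] := Hf (f x); rewrite // fK eq_sym.
Qed.

Let disjoint_BU f : matching (adjacent H) U f -> [disjoint B & pairs f U].
Proof.
move=> mf; apply/pred0P=> b /=; apply/negP=> /andP[].
rewrite inE => /andP[_ b2] /imsetP[x _ E].
by move: b2; rewrite E cards2; case: (_ != _).
Qed.

Lemma extend_partition f : matching (adjacent H) U f -> partition (extend f) V.
Proof.
move=> mf; have [fK Hf] := matchingP _ _ _ mf.
have /and3P[/eqP cP tP nP] := pairs_partition fK (fU mf).
have tB : trivIset B by apply: trivIsetS BC0 (partition_trivIset pC0).
apply/and3P; split.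
- rewrite /cover bigcup_setU -/(cover B) -/(cover (pairs f U)) cP.
  by rewrite -[X in _ == X](setID V (cover B)) (setIidPr coverBV).
- apply: trivIsetU; rewrite // cP.
  by rewrite disjoint_sym disjoints_subset subsetDr.
- rewrite inE negb_or nP andbT; apply/negP=> /(subsetP BC0).
  by case/and3P: pC0 => _ _ /negP.
Qed.

Lemma extend_sub f : matching (adjacent H) U f -> extend f \subset eset H.
Proof.
case/matchingP=> fK Hf; rewrite subUset (subset_trans BC0 C0E) /=.
apply/subsetP=> _ /imsetP[x xU ->]; have [->|fx] := eqVneq (f x) x.
  by rewrite setUid set1_eset // UV.
by have [_ /adjacentP[]] := Hf x fx.
Qed.

Lemma extend_cover f : matching (adjacent H) U f -> is_cover H (extend f).
Proof.
move=> mf; rewrite /is_cover extend_sub //=.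
by rewrite (cover_partition (extend_partition mf)).
Qed.

Let fixU f : {set T} := [set x in U | f x == x].

Lemma extend_card f : matching (adjacent H) U f ->
  2 * #|extend f| = 2 * #|B| + #|U| + #|fixU f|.
Proof.
move=> mf; have [fK Hf] := matchingP _ _ _ mf.
have /eqP -> : #|extend f| == #|B| + #|pairs f U|.
  by rewrite (leq_card_setU B (pairs f U)).2 disjoint_BU.
by rewrite mulnDr (pairs_card fK (fU mf)) addnA.
Qed.

Let unmatched_fixU f : matching (adjacent H) U f ->
  #|unmatched f| = #|fixU f| + #|~: U|.
Proof.
move=> mf; rewrite -(cardsID U (unmatched f)).
congr (_ + _); apply: eq_card => x; first by rewrite !inE andbC.
rewrite in_setD in_setC [x \in unmatched f]inE; apply/andb_idr => xU.
by rewrite (matching_fix_out mf xU).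
Qed.

(** The matching whose edges are the blocks of size 2 of C0. *)
Definition block_matching : {ffun T -> T} :=
  [ffun x => odflt x [pick y | (y != x) && ([set x; y] \in C0)]].

Let f0 := block_matching.

Lemma block_matchingP x :
  f0 x = x /\ (forall y, y != x -> [set x; y] \notin C0) \/
  f0 x != x /\ [set x; f0 x] \in C0.
Proof.
rewrite ffunE; case: pickP => [y /andP[yx xyC]|no]; [by right | left].
by split=> // y yx; have := no y; rewrite yx /= => ->.
Qed.

Let block_eq b b' x : b \in C0 -> b' \in C0 -> x \in b -> x \in b' -> b = b'.
Proof.
have tC := partition_trivIset pC0.
by move=> bC bC' xb xb'; rewrite -(def_pblock tC bC xb) (def_pblock tC bC' xb').
Qed.

Lemma matching_block : matching (adjacent H) U f0.
Proof.
have inv x : f0 x != x -> f0 (f0 x) = x.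
  case: (block_matchingP x) => [[->]|[fx xC] _]; first by rewrite eqxx.
  case: (block_matchingP (f0 x)) => [[_ /(_ x)]|[ffx yC]].
    by rewrite eq_sym fx setUC xC => /(_ isT).
  have E := block_eq xC yC (set22 _ _) (set21 _ _).
  have : f0 (f0 x) \in [set x; f0 x] by rewrite E set22.
  by rewrite !inE (negbTE ffx) orbF => /eqP.
apply/matchingP; split=> x.
  by have [E|/inv//] := eqVneq (f0 x) x; rewrite !E.
move=> fx; case: (block_matchingP x) => [[E]|[_ xC]]; first by rewrite E eqxx in fx.
have xE := subsetP C0E _ xC; split; last by apply/adjacentP; rewrite eq_sym.
rewrite inE andbC (subsetP (eset_vset xE)) ?set21 //=.
apply/bigcupP=> -[b]; rewrite inE => /andP[bC b2] xb.
move: b2; rewrite (block_eq bC xC xb (set21 _ _)) cards2; by case: (_ != _).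
Qed.

Lemma extend_block : extend f0 \subset C0.
Proof.
rewrite subUset BC0 /=; apply/subsetP=> _ /imsetP[x xU ->].
case: (block_matchingP x) => [[-> no]|[]//].
have xV : x \in cover C0 by rewrite (cover_partition pC0) UV.
have pxC : pblock C0 x \in C0 by rewrite pblock_mem.
have xp : x \in pblock C0 x by rewrite mem_pblock.
have le2 : #|pblock C0 x| <= 2.
  rewrite leqNgt; apply/negP=> lt; move: xU; rewrite in_setD => /andP[/negP nB _].
  by apply: nB; apply/bigcupP; exists (pblock C0 x); rewrite // inE pxC.
rewrite setUid; suff <- : pblock C0 x = [set x] by [].
apply/eqP; rewrite eq_sym eqEcard sub1set xp cards1 leqNgt; apply/negP=> lt.
have /cards2P[y [z [yz E]]] : #|pblock C0 x| == 2 by rewrite eqn_leq le2.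
move: xp pxC; rewrite E in_set2 => /orP[]/eqP xE yzC.
  by have := no z; rewrite xE eq_sym yz yzC => /(_ isT).
by have := no y; rewrite xE yz setUC yzC => /(_ isT).
Qed.

(** A larger matching would extend to a cover with fewer than rho H hyperedges. *)
Lemma max_matching_block : max_matching (adjacent H) U f0.
Proof.
have m0 := matching_block; apply/max_matchingP; split=> // g mg.
rewrite !unmatched_fixU // leq_add2r -(leq_add2l (2 * #|B| + #|U|)).
rewrite -!extend_card // leq_mul2l /=.
apply: leq_trans (rho_le coverH (extend_cover mg)).
by rewrite -card_C0 subset_leq_card // extend_block.
Qed.

Lemma optimal_extend f : max_matching (adjacent H) U f ->
  [/\ optimal H (extend f), #|extend f| = rho H & singletons (extend f) = fixU f].
Proof.
move=> mf; have /max_matchingP[mf1 Hf] := mf.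
have m0 := matching_block.
have le_fix : #|fixU f| <= #|fixU f0|.
  by have := Hf _ m0; rewrite !unmatched_fixU // leq_add2r.
have cf : #|extend f| = rho H.
  apply/eqP; rewrite eqn_leq rho_le ?extend_cover // andbT -card_C0.
  apply: leq_trans (subset_leq_card extend_block).
  by rewrite -(leq_pmul2l (ltn0Sn 1)) !extend_card // leq_add2l.
have mpf : minimum_partition_cover H (extend f).
  by apply/andP; rewrite extend_partition // /minimum_cover extend_cover // cf eqxx.
have sing : singletons (extend f) = fixU f.
  apply/setP=> x; rewrite [x \in singletons _]in_set [x \in fixU f]in_set in_setU.
  apply/orP/andP.
    case=> [|/imsetP[z zU E]]; first by rewrite in_set cards1 andbF.
    have zx : z = x by apply/set1P; rewrite E set21.
    by rewrite -{1}zx zU; split=> //; rewrite -in_set1 E zx set22.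
  case=> xU /eqP fx; right; apply/imsetP; exists x => //.
  by rewrite fx setUid.
split=> //; split=> // C' mC'; rewrite sing; apply: leq_trans le_fix _.
have [_ minC0] := optC0; apply: leq_trans (minC0 _ mC').
apply/subset_leq_card/subsetP=> x; rewrite [x \in fixU f0]in_set => /andP[xU /eqP fx].
rewrite in_set; apply: (subsetP extend_block); apply/setUP; right.
apply/imsetP; exists x => //.
by rewrite fx setUid.
Qed.

Let D := missable (adjacent H) U.

Let DU x : x \in D -> x \in U. Proof. by case/missableP. Qed.

(** Some optimal cover has x as a singleton and shares its hyperedges of size at
    least 3 with C0. *)
Lemma missable_no_big x y : x \in D -> y \in cover B -> ~~ adjacent H x y.
Proof.
case/missableP=> xU [f mf fx] /bigcupP[b bB yb].
have [opt _ sing] := optimal_extend mf.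
have bf : b \in extend f by rewrite inE bB.
apply: optimal_no_big_neighbour opt _ bf yb _ => //.
  have : x \in singletons (extend f) by rewrite sing in_set fx eqxx xU.
  by rewrite inE.
by move: bB; rewrite inE => /andP[].
Qed.

Lemma missable_neighbour x y : x \in D -> adjacent H x y ->
  y \in D \/ y \in frontier (adjacent H) U.
Proof.
move=> xD axy; have /andP[_ yV] := adjacent_vset axy.
have yU : y \in U.
  rewrite in_setD yV andbT; apply/negP=> yB.
  by have := missable_no_big xD yB; rewrite axy.
have [yD|yD] := boolP (y \in D); [by left | right].
by apply/frontierP; split=> //; exists x => //; rewrite adjacent_sym.
Qed.

Let K := component (adjacent H) U.

Let KD x : K x \subset D.
Proof. by apply/subsetP=> y; rewrite componentE => /andP[]. Qed.

Let meeting (X : {set T}) (C : {set {set T}}) : {set {set T}} :=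
  [set c in C | ~~ [disjoint c & X]].

Let meetingP (X : {set T}) C c :
  reflect (c \in C /\ exists2 x, x \in c & x \in X) (c \in meeting X C).
Proof.
rewrite in_set; apply: (iffP andP) => -[cC].
  by case/pred0Pn=> x /andP[xc xX]; split=> //; exists x.
by case=> x xc xX; split=> //; apply/pred0Pn; exists x; rewrite /= xc.
Qed.

(** For x in the component, take a maximum matching missing x: it covers the
    component by exactly (|K| + 1) / 2 blocks, all inside the component.
    Replacing these blocks by the members of C that meet the component gives
    another cover, so there are at least as many of those. *)
Lemma component_cover C x : is_cover H C -> x \in D ->
  #|K x| < 2 * #|meeting (K x) C|.
Proof.
move=> /andP[CE /eqP CV] xD; have /missableP[xU [f mf fx]] := xD.
have [_ cf _] := optimal_extend mf; have /max_matchingP[mf1 _] := mf.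
rewrite -(component_pairs_missed (@adjacent_sym _ H) mf xD fx).
rewrite leq_pmul2l //; set P := pairs f (K x); set M := meeting _ _.
have PK p : p \in P -> p \subset K x.
  case/imsetP=> z zK ->; apply/subsetP=> y; rewrite in_set2.
  have [fz _] := component_missed (@adjacent_sym _ H) mf xD fx zK.
  by case/orP=> /eqP->.
have Pf : P \subset extend f.
  apply/subsetP=> p /imsetP[z zK ->]; apply/setUP; right; apply/imsetP.
  by exists z => //; apply: DU; apply: (subsetP (KD x)).
have cov : is_cover H (extend f :\: P :|: M).
  apply/andP; split.
    rewrite subUset (subset_trans (subsetDl _ _) (extend_sub mf1)) /=.
    by apply: subset_trans CE; apply/subsetP=> c /meetingP[].
  rewrite eqEsubset; apply/andP; split.
    apply/bigcupsP=> c /setUP[/setDP[cf' _]|/meetingP[cC _]].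
      exact/eset_vset/(subsetP (extend_sub mf1)).
    exact/eset_vset/(subsetP CE).
  apply/subsetP=> v vV; apply/bigcupP; have [vK|vK] := boolP (v \in K x).
    have : v \in cover C by rewrite CV.
    case/bigcupP=> c cC vc; exists c => //; apply/setUP; right.
    by apply/meetingP; split=> //; exists v.
  have : v \in cover (extend f).
    by rewrite (cover_partition (extend_partition mf1)).
  case/bigcupP=> c cf' vc; exists c => //; apply/setUP; left.
  rewrite in_setD cf' andbT; apply: contra vK => /PK/subsetP; exact.
have := rho_le coverH cov; rewrite -cf -(cardsID P (extend f)) (setIidPr Pf).
move=> le; have := leq_trans le (leq_card_setU _ _).
by rewrite [X in _ <= X]addnC leq_add2r.
Qed.

Let K_eq x y : y \in K x -> K x = K y.
Proof.
have sym : connect_sym (missable_adj (adjacent H) U).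
  by apply: sym_connect_sym => u v; rewrite /missable_adj /= adjacent_sym andbCA.
rewrite componentE => /andP[_ cxy]; apply/setP=> z; rewrite !componentE.
by rewrite (same_connect sym cxy).
Qed.

Let KK x : x \in D -> x \in K x.
Proof. by move=> xD; rewrite componentE xD connect0. Qed.

(** A hyperedge meets at most one component of D, its vertices being pairwise
    adjacent; so the comparison can be made component by component, where
    component_pairs_le and component_cover give the two bounds. *)
Lemma meeting_missable_le C :
  is_cover H C -> #|meeting D (extend f0)| <= #|meeting D C|.
Proof.
move=> covC; have /andP[CE _] := covC.
pose P := K @: D.
have inP X : X \in P -> exists2 x, x \in D & X = K x by case/imsetP=> x; exists x.
apply: (@leq_trans (\sum_(X in P) #|pairs f0 X|)).
  apply: (@leq_trans #|\bigcup_(X in P) pairs f0 X|).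
    apply/subset_leq_card/subsetP=> c /meetingP[cf [x xc xD]].
    apply/bigcupP; exists (K x); first exact: imset_f.
    apply/imsetP; exists x; first exact: KK.
    case/setUP: cf => [cB|/imsetP[z zU E]].
      have := DU xD; rewrite in_setD => /andP[/negP nB _].
      by case: nB; apply/bigcupP; exists c.
    move: xc; rewrite E !inE => /orP[]/eqP-> //.
    have [fK _] := matchingP _ _ _ matching_block.
    by rewrite fK setUC.
  elim/big_rec2: _ => [|X n A _ le]; first by rewrite cards0.
  by apply: leq_trans (leq_card_setU _ _) _; rewrite leq_add2l.
apply: (@leq_trans (\sum_(X in P) #|meeting X C|)).
  apply: leq_sum => X /inP[x xD ->]; rewrite -(leq_pmul2l (ltn0Sn 1)).
  apply: leq_trans (component_cover covC xD).
  exact: (component_pairs_le (@adjacent_sym T H) (f := f0) x max_matching_block).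
have -> : \sum_(X in P) #|meeting X C| =
    \sum_(c in C) #|[set X in P | ~~ [disjoint c & X]]|.
  under eq_bigr => X _ do rewrite -sum1dep_card big_mkcondr.
  by rewrite exchange_big; apply: eq_bigr => c _; rewrite -sum1dep_card -big_mkcondr.
rewrite -sum1dep_card big_mkcondr; apply: leq_sum => c cC.
case: ifP => [_|/negbFE dis]; last first.
  rewrite leqn0 cards_eq0; apply/eqP/setP=> X; rewrite !inE.
  apply/negP=> /andP[/inP[x _ ->]] /negP[].
  by rewrite disjoint_sym; apply: disjointWl (KD x) _; rewrite disjoint_sym.
apply/card_le1_eqP=> X Y; rewrite !in_set.
move=> /andP[/inP[x xD ->] /pred0Pn[u /andP[/= uc uX]]].
move=> /andP[/inP[y yD ->] /pred0Pn[v /andP[/= vc vY]]].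
rewrite (K_eq uX) (K_eq vY); have [->//|uv] := eqVneq u v.
have uD := subsetP (KD _) _ uX; have vD := subsetP (KD _) _ vY.
apply: K_eq; rewrite componentE uD connect1 //; apply/and3P; split=> //.
by rewrite adjacent_sym (adjacent_hyperedge _ (subsetP CE _ cC) uc vc).
Qed.

(** Let C be a minimum cover that contains {a}, with a in the frontier. Take the
    hyperedges of the cover extending f0 that meet D, and the members of C other
    than {a} that avoid D. The former cover D and the frontier, as every
    frontier vertex is matched into D; the latter cover what remains, as D has no
    neighbours there. By meeting_missable_le this cover is smaller than C. *)
Lemma frontier_empty : critical H -> frontier (adjacent H) U = set0.
Proof.
move=> crit; apply/setP=> a; rewrite in_set0; apply/negP=> aA.
have /frontierP[aU aD _] := aA.
have [C [covC aC cardC]] := critical_singleton_cover coverH hereditaryH crit (UV aU).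
have /andP[CE /eqP CV] := covC.
have f0E := extend_sub matching_block.
pose Y := [set c in C | [disjoint c & D]] :\ [set a].
have cov : is_cover H (meeting D (extend f0) :|: Y).
  apply/andP; split.
    rewrite subUset; apply/andP; split.
      by apply: subset_trans f0E; apply/subsetP=> c /meetingP[].
    by apply: subset_trans CE; apply/subsetP=> c; rewrite !inE => /andP[_ /andP[]].
  rewrite eqEsubset; apply/andP; split.
    apply/bigcupsP=> c /setUP[/meetingP[cf _]|].
      exact/eset_vset/(subsetP f0E).
    by rewrite !inE => /andP[_ /andP[cC _]]; exact/eset_vset/(subsetP CE).
  apply/subsetP=> v vV; apply/bigcupP.
  have vf w : w \in U -> [set w; f0 w] \in extend f0.
    by move=> wU; apply/setUP; right; exact: imset_f.
  have [vD|vD] := boolP (v \in D).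
    exists [set v; f0 v]; last exact: set21.
    apply/setUP; left; apply/meetingP; split; first exact/vf/DU.
    by exists v; rewrite ?set21.
  have [vA|vA] := boolP (v \in frontier (adjacent H) U).
    exists [set v; f0 v]; last exact: set21.
    apply/setUP; left; apply/meetingP; split.
      by apply: vf; case/frontierP: vA.
    exists (f0 v); first exact: set22.
    exact: (frontier_matched (@adjacent_sym T H) (f := f0) max_matching_block vA).
  have : v \in cover C by rewrite CV.
  case/bigcupP=> c cC vc; exists c => //; apply/setUP; right.
  rewrite !inE cC /=; apply/andP; split.
    by apply: contraNneq vA => E; move: vc; rewrite E inE => /eqP->.
  apply/pred0P=> x /=; apply/negP=> /andP[xc xD].
  have xv : x != v by apply: contraNneq vD => <-.
  have := adjacent_hyperedge hereditaryH (subsetP CE _ cC) xc vc xv.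
  by case/(missable_neighbour xD)=> vX; [rewrite vX in vD | rewrite vX in vA].
have le_rho := leq_trans (rho_le coverH cov) (leq_card_setU _ _).
have aY : [set a] \in [set c in C | [disjoint c & D]].
  by rewrite inE aC disjoints1.
have cC : #|C| = #|meeting D C| + #|Y|.+1.
  rewrite -(cardsID (meeting D C) C); congr (_ + _).
    by apply: eq_card => c; rewrite !inE andbA andbb.
  have := cardsD1 [set a] [set c in C | [disjoint c & D]].
  rewrite aY add1n => <-; apply: eq_card => c; rewrite !inE.
  by case: (c \in C); rewrite ?andbF //= negbK andbT.
rewrite cC in cardC; have le := leq_add (meeting_missable_le covC) (leqnn #|Y|).
by have := leq_trans cardC (leq_trans le_rho le); rewrite leq_add2l ltnn.
Qed.

(** With the frontier empty, D is closed under adjacency, hence is all of V and a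
    single component: C0 has no hyperedge of size at least 3, and every maximum
    matching misses exactly one vertex, which can be any vertex. *)
Lemma factor_critical_case : critical H -> connected H -> singletons C0 != set0 ->
  2 * rho H = #|vset H| + 1 /\
  forall v, v \in vset H -> exists C, minimum_partition_cover H C /\
    [set v] \in C /\ forall c : {set T}, c \in C -> c <> [set v] -> #|c| = 2.
Proof.
move=> crit conn /set0Pn[x0]; rewrite inE => x0C.
have no_frontier := frontier_empty crit.
have x0V : x0 \in V.
  rewrite -(cover_partition pC0); apply/bigcupP.
  by exists [set x0]; rewrite ?set11.
have x0D : x0 \in D.
  apply/missableP; split.
    rewrite in_setD x0V andbT; apply/bigcupP=> -[b]; rewrite inE => /andP[bC b2] xb.
    by move: b2; rewrite -(block_eq x0C bC (set11 _) xb) cards1.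
  exists f0; first exact: max_matching_block.
  case: (block_matchingP x0) => [[]//|[fx xC]].
  have E := block_eq x0C xC (set11 _) (set21 _ _).
  by apply/set1P; rewrite E set22.
have VK : V \subset K x0.
  apply/subsetP=> y yV; have /connectP[p pth ->] := conn x0 y x0V yV.
  elim: p x0 x0D pth {x0C x0V y yV} => [|z p IH] x xD /=; first by move=> _; exact: KK.
  case/andP=> axz pth; have zD : z \in D.
    by case: (missable_neighbour xD axz) => //; rewrite no_frontier in_set0.
  have zK : z \in K x by rewrite componentE zD connect1 // /missable_adj /= xD zD.
  by rewrite (K_eq zK); exact: IH.
have UVe : U = V.
  apply/eqP; rewrite eqEsubset; apply/andP; split; apply/subsetP=> x; first exact: UV.
  by move=> xV; apply/DU/(subsetP (KD x0))/(subsetP VK).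
have B0 : B = set0.
  apply/setP=> b; rewrite in_set0; apply/negP=> bB.
  have : b != set0 by move: bB; rewrite inE -card_gt0 => /andP[_ /ltnW/ltnW].
  case/set0Pn=> x xb; have xB : x \in cover B by apply/bigcupP; exists b.
  by have := subsetP coverBV _ xB; rewrite -UVe in_setD xB.
have near_perfect v : v \in V -> exists f,
    [/\ max_matching (adjacent H) U f, f v = v & fixU f = [set v]].
  move=> vV; have vK := subsetP VK _ vV.
  have vD := subsetP (KD _) _ vK; have /missableP[vU [f mf fv]] := vD.
  exists f; split=> //; apply/setP=> z; rewrite in_set1 [z \in fixU f]in_set.
  apply/andP/eqP => [[zU /eqP fz]|->]; last by rewrite fv.
  have zK : z \in K v by rewrite -(K_eq vK); apply: (subsetP VK); apply: UV.
  by have [_] := component_missed (@adjacent_sym _ H) mf vD fv zK; apply.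
split.
  have [f [mf fx fixf]] := near_perfect x0 x0V; have /max_matchingP[mf1 _] := mf.
  have [_ <- _] := optimal_extend mf.
  by rewrite extend_card // fixf B0 cards0 cards1 UVe.
move=> v vV; have [f [mf fv fixf]] := near_perfect v vV.
have [[mpc _] _ sing] := optimal_extend mf.
exists (extend f); split=> //; split.
  have : v \in singletons (extend f) by rewrite sing fixf set11.
  by rewrite inE.
move=> c /setUP[|/imsetP[z zU ->]]; first by rewrite B0 in_set0.
rewrite cards2; have [fz|//] := eqVneq z (f z).
have zv : z = v by apply/set1P; rewrite -fixf in_set zU -fz eqxx.
by rewrite -fz zv setUid.
Qed.

End FromMatching.

(** * The generalized Gallai theorem *)


Theorem mainTheorem1 (T : finType) (H : hypergraph T)
    (coverH : is_cover H (eset H))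
    (connectedH : connected H)
    (hereditaryH : hereditary H)
    (criticalH : critical H) :
  2 * rho H <= #|vset H| + 1 /\
  ((2 * rho H < #|vset H| + 1 /\
    exists C : {set {set T}}, minimum_partition_cover H C /\
      forall e : {set T}, e \in C -> #|e| <> 1)
   \/
   (2 * rho H = #|vset H| + 1 /\
    forall v : T, v \in vset H ->
    exists C : {set {set T}}, minimum_partition_cover H C /\
      [set v] \in C /\
      forall e : {set T}, e \in C -> e <> [set v] -> #|e| = 2)).
Proof.
have [C optC] := optimal_exists coverH hereditaryH.
have [s0|s1] := eqVneq (singletons C) set0; last first.
  have [eq cov] := factor_critical_case coverH hereditaryH optC criticalH connectedH s1.
  by rewrite eq; split=> //; right.
have [mpc _] := optC; have /andP[/andP[_ /eqP cardC] pC] := mpc.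
have no1 e : e \in C -> #|e| <> 1.
  move=> eC /eqP/cards1P[x E]; have : x \in singletons C by rewrite inE -E.
  by rewrite s0 in_set0.
have lt : 2 * rho H < #|vset H| + 1.
  rewrite addn1 ltnS -cardC (card_partition pC) -sum1_card big_distrr /=.
  apply: leq_sum => e eC; rewrite muln1 ltn_neqAle card_gt0 eq_sym.
  apply/andP; split; first exact/eqP/no1.
  by apply: contraTneq eC => ->; case/and3P: pC.
by split; [exact: ltnW | left; split=> //; exists C].
Qed.
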